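(* Let $n \ge 2$ and $N \ge 1$ be integers. For $f,g \in \mathcal{E}$ (defined below) one has $E f \ge 0$ and $E(fg) \ge (E f)(E g)$, where $$E f = \int f(\sigma_1,\dots,\sigma_N)\, d\sigma_1 \cdots d\sigma_N$$ and each $d\sigma_i$ is normalized Lebesgue (uniform probability) measure on the unit sphere $\mathbb{S}^{n-1}\subset\mathbb{R}^n$.
   Context: Variables $\sigma_1,\dots,\sigma_N$ range over $\mathbb{S}^{n-1}$, and $\sigma_i\cdot\sigma_j$ denotes the Euclidean inner product in $\mathbb{R}^n$. $\mathcal{E}$ is the set of (finite) linear combinations with positive coefficients of monomials of the form $\prod_{1\le i<j\le N} (\sigma_i\cdot\sigma_j)^{n_{i,j}}$, where the $n_{i,j}\ge 0$ are integers. *)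

(* Defs.v *)
From HB Require Import structures.
From mathcomp Require Import all_boot all_order all_algebra.
From mathcomp Require Import all_classical all_reals all_analysis.
Set Implicit Arguments. Unset Strict Implicit. Unset Printing Implicit Defensive.
Import Order.TTheory GRing.Theory Num.Theory.
Local Open Scope ring_scope.
Local Open Scope classical_set_scope.

Section Defs.
Variable R : realType.

Definition dotR (n : nat) (u v : 'rV[R]_n) : R := \sum_(k < n) u ord0 k * v ord0 k.
Definition eucl (n : nat) (u : 'rV[R]_n) : R := Num.sqrt (dotR u u).
Definition on_sphere (n : nat) (u : 'rV[R]_n) : Prop := eucl u = 1.

Definition in_E (n N : nat) (f : ('I_N -> 'rV[R]_n) -> R) : Prop :=
  exists (m : nat) (c : 'I_m -> R) (e : 'I_m -> 'I_N -> 'I_N -> nat),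
    (forall k, 0 < c k) /\
    forall sigma : 'I_N -> 'rV[R]_n, (forall i, on_sphere (sigma i)) ->
      f sigma = \sum_(k < m) c k *
                 \prod_(i < N) \prod_(j < N | (i < j)%N)
                   dotR (sigma i) (sigma j) ^+ e k i j.

Fixpoint iter_int (k : nat) (F : seq R -> R) : R :=
  match k with
  | 0 => F [::]
  | k'.+1 => Rintegral (@lebesgue_measure R) `[-1, 1]%classic
               (fun x : R => iter_int k' (fun s => F (x :: s)))
  end.

Definition block (n N : nat) (s : seq R) (i : 'I_N) : 'rV[R]_n :=
  \row_(k < n) nth 0 s (i * n + k).

Definition balls_ind (n N : nat) (s : seq R) : R :=
  if [forall i : 'I_N, (0 < eucl (block n s i)) && (eucl (block n s i) <= 1)]
  then 1 else 0.

Definition normalize (n : nat) (u : 'rV[R]_n) : 'rV[R]_n := (eucl u)^-1 *: u.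

(* E f = integral of f over (S^{n-1})^N w.r.t. the product of the normalized
   (uniform probability) surface measures.  The normalized surface measure on
   S^{n-1} is the push-forward of normalized Lebesgue measure on the unit ball
   under x |-> x/|x| (cone-measure definition), hence: *)
Definition Esph (n N : nat) (f : ('I_N -> 'rV[R]_n) -> R) : R :=
  iter_int (N * n) (fun s => balls_ind n N s * f (fun i => normalize (block n s i)))
  / iter_int (N * n) (balls_ind n N).

End Defs.

(* Main.v *)
Require Import Defs.
From HB Require Import structures.
From mathcomp Require Import all_boot all_order all_algebra.
From mathcomp Require Import all_classical all_reals all_analysis.
From mathcomp Require Import measurable_realfun.
From mathcomp Require Import ring lra zify.
Set Implicit Arguments. Unset Strict Implicit. Unset Printing Implicit Defensive.
Import Order.TTheory GRing.Theory Num.Theory.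
Import numFieldNormedType.Exports.
Local Open Scope classical_set_scope.
Local Open Scope ring_scope.

(* A monomial is a multigraph on the vertices: the list [es] of its edges.  Rotation
   invariance yields a Wick recursion on [E(es)]: for an edge (v, w) with v <> w,
   (n - 1 + deg) E((v, w) :: es) is the sum of E over all the graphs obtained from
   [es] by moving one half-edge from v to w, where deg is the degree of v in [es].
   This gives E >= 0, and also that identifying two vertices does not decrease E:
   the recursions of both graphs agree except at an edge between these two vertices,
   where there are deg <= n - 1 + deg terms, each bounded by the merged graph by
   induction.  Finally E f E g is the expectation of the disjoint union of the two
   graphs; merging each vertex of f with its copy in g turns it into E(fg).

   The recursion comes from moments of the unit ball with weight |x|^-d.  In a
   coordinate plane, invariance under rotations (products of shears, hence reducible
   to translations of one variable) gives I((x + t y)^d) = (1 + t^2)^(d/2) I(x^d),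
   and comparing coefficients of t relates the mixed moments. *)

(** * Wick recursion on multigraphs *)

(** Listed with multiplicity, so that the size of the list is the degree of [v]; a loop at [v]
    contributes two graphs. *)
Fixpoint reattach (V : eqType) (v w : V) (es : seq (V * V)) : seq (seq (V * V)) :=
  if es is (i, j) :: es' then
    nseq (i == v) ((w, j) :: es') ++ nseq (j == v) ((i, w) :: es')
      ++ map (cons (i, j)) (reattach v w es')
  else [::].

Definition relabel (V W : Type) (m : V -> W) (es : seq (V * V)) : seq (W * W) :=
  [seq (m e.1, m e.2) | e <- es].

(** The loop rule reflects that [sigma v] is a unit vector. Every rule relates graphs with fewer
    edges or flips an edge, which is why the proofs below go by induction on the number of edges. *)
Definition wick (R : realFieldType) (V : eqType) (n : nat) (E : seq (V * V) -> R) : Prop :=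
  [/\ E [::] = 1,
      forall v es, E ((v, v) :: es) = E es,
      forall i j es, E ((i, j) :: es) = E ((j, i) :: es)
    & forall i j es, i != j ->
        (n.-1 + size (reattach i j es))%:R * E ((i, j) :: es)
        = \sum_(es' <- reattach i j es) E es'].

Lemma size_reattach_mem (V : eqType) (v w : V) es es' :
  es' \in reattach v w es -> size es' = size es.
Proof.
elim: es es' => [|[i j] es IH] //= es'; rewrite !mem_cat => /or3P[||/mapP[x /IH <- ->//]];
 by rewrite mem_nseq => /andP[_ /eqP->].
Qed.

(** Only the endpoints equal to [v] are touched, so [m] may still identify other vertices. This
    covers both injective relabelings and merges away from [v]. *)
Lemma reattach_relabel (V W : eqType) (m : V -> W) (v w : V) (es : seq (V * V)) :
  (forall u, (m u == m v) = (u == v)) ->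
  reattach (m v) (m w) (relabel m es) = map (relabel m) (reattach v w es).
Proof.
move=> mv; elim: es => [|[i j] es IH] //=.
rewrite !mv IH !map_cat -!map_comp.
by case: (i == v); case: (j == v).
Qed.

(** Moving an endpoint between two vertices with the same image is invisible after [m]. *)
Lemma relabel_reattach (V W : eqType) (m : V -> W) (v w : V) es es' :
  m v = m w -> es' \in reattach v w es -> relabel m es' = relabel m es.
Proof.
move=> mvw; elim: es es' => [|[i j] es IH] //= es'.
rewrite !mem_cat => /or3P[||/mapP[x /IH xE ->/=]]; last by rewrite xE.
  by rewrite mem_nseq; case: eqP => // -> /eqP->/=; rewrite mvw.
by rewrite mem_nseq; case: eqP => // -> /eqP->/=; rewrite mvw.
Qed.

Lemma reattach_cat (V : eqType) (v w : V) es1 es2 :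
  all (fun e => (e.1 != v) && (e.2 != v)) es2 ->
  reattach v w (es1 ++ es2) = [seq es' ++ es2 | es' <- reattach v w es1].
Proof.
move=> h; elim: es1 => [|[i j] es IH] /=.
  elim: es2 h => [|[i j] es IH] //= /andP[/andP[/negPf-> /negPf->] /IH->] //.
rewrite IH !map_cat -!map_comp.
by case: (i == v); case: (j == v).
Qed.

Section Wick.
Variables (R : realFieldType) (n : nat).
Hypothesis n_gt1 : (1 < n)%N.

Lemma wick_gt0 k : 0 < (n.-1 + k)%:R :> R.
Proof. by rewrite ltr0n; lia. Qed.

Lemma wick_ge0 (V : eqType) (E : seq (V * V) -> R) es : wick n E -> 0 <= E es.
Proof.
move=> [E0 El Ef Er]; have [k] := ubnP (size es); elim: k es => // k IH [|[i j] es] /=.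
  by rewrite E0.
rewrite ltnS => sk; have [->|ij] := eqVneq i j; first by rewrite El IH.
rewrite -(pmulr_rge0 _ (wick_gt0 (size (reattach i j es)))) Er//.
by rewrite big_seq sumr_ge0// => es' r; apply: IH; rewrite (size_reattach_mem r).
Qed.

(** The recursion determines its solution, because its normalizing factor is positive; an injective
    [m] carries one recursion to the other. *)
Lemma wick_relabel (V W : eqType) (m : V -> W) E E' (es : seq (V * V)) :
  injective m -> wick n E -> wick n E' -> E' (relabel m es) = E es :> R.
Proof.
move=> mI [E0 El Ef Er] [E0' El' Ef' Er'].
have [k] := ubnP (size es); elim: k es => // k IH [|[i j] es] /=.
  by rewrite E0 E0'.
rewrite ltnS => sk; have [->|ij] := eqVneq i j; first by rewrite El El' IH.
have rE := @reattach_relabel V W m i j es (fun u => inj_eq mI u i).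
apply: (mulfI (lt0r_neq0 (wick_gt0 (size (reattach i j es))))).
rewrite Er//; have := Er' (m i) (m j) (relabel m es).
rewrite inj_eq// rE size_map big_map => -> //.
by rewrite big_seq [RHS]big_seq; apply: eq_bigr => es1 r; apply: IH; rewrite (size_reattach_mem r).
Qed.

(** Independence of two graphs separated by [P]: the recursion at an edge of [es1] leaves [es2]
    untouched. *)
Lemma wick_cat (V : eqType) (E : seq (V * V) -> R) (P : pred V) es1 es2 :
  wick n E -> all (fun e => P e.1 && P e.2) es1 ->
  all (fun e => ~~ P e.1 && ~~ P e.2) es2 -> E (es1 ++ es2) = E es1 * E es2.
Proof.
move=> [E0 El Ef Er]; have [k] := ubnP (size es1).
elim: k es1 => // k IH [|[i j] es] /=; first by rewrite E0 mul1r.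
rewrite ltnS => sk /andP[/andP[Pi Pj] Pes] Pes2.
have [->|ij] := eqVneq i j; first by rewrite !El IH.
have rE : reattach i j (es ++ es2) = [seq es' ++ es2 | es' <- reattach i j es].
  apply: reattach_cat; apply: sub_all Pes2 => e /andP[e1 e2].
  by apply/andP; split; [apply: contraNneq e1|apply: contraNneq e2] => ->.
apply: (mulfI (lt0r_neq0 (wick_gt0 (size (reattach i j es))))).
rewrite mulrA Er//; have := Er i j (es ++ es2) ij.
rewrite rE size_map big_map => ->; rewrite mulr_suml.
rewrite big_seq [RHS]big_seq; apply: eq_bigr => es' r; apply: IH => //.
  by rewrite (size_reattach_mem r).
(* Reattaching from [i] to [j] keeps all endpoints in [P], since [P j] holds. *)
elim: es {sk rE} es' Pes r => [|[a b] es IHe] es' //= /andP[/andP[Pa Pb] Pe].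
rewrite !mem_cat => /or3P[||/mapP[x /(IHe _ Pe) xE ->/=]]; last by rewrite Pa Pb.
  by rewrite mem_nseq => /andP[_ /eqP->]/=; rewrite Pj Pb.
by rewrite mem_nseq => /andP[_ /eqP->]/=; rewrite Pa Pj.
Qed.

(* When the edge joins [v] and [v'], reattaching keeps the merged graph, and the
   number of terms of the recursion does not exceed its normalizing factor. *)
Lemma wick_merge (V : eqType) (E : seq (V * V) -> R) (v v' : V) es :
  wick n E -> E es <= E (relabel (fun u => if u == v' then v else u) es).
Proof.
set m := fun u => _ => wE; have [E0 El Ef Er] := wE.
have [k] := ubnP (size es); elim: k es => // k IH [|[i j] es] //=.
rewrite ltnS => sk; have [->|ij] := eqVneq i j; first by rewrite !El IH.
have pos r := wick_gt0 (size r).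
have [mij|mij] := eqVneq (m i) (m j).
  rewrite mij El -(ler_pM2l (pos _ (reattach i j es))) Er//.
  apply: (@le_trans _ _ (\sum_(es' <- reattach i j es) E (relabel m es))).
    rewrite big_seq [leRHS]big_seq; apply: ler_sum => es' r.
    by rewrite -(relabel_reattach mij r) IH// (size_reattach_mem r).
  rewrite big_const_seq iter_addr_0 count_predT -[leLHS]mulr_natl.
  by rewrite ler_wpM2r ?(wick_ge0 _ wE)// ler_nat leq_addl.
(* At an endpoint [x] outside the merged pair, the recursion commutes with the merge, and the two
   sides compare term by term. *)
have free x y : x != y -> m x != m y -> x != v -> x != v' ->
    E ((x, y) :: es) <= E ((m x, m y) :: relabel m es).
  move=> xy mxy xv xv'.
  have mx u : (m u == m x) = (u == x).
    rewrite /m (negPf xv'); case: (u =P v') => // ->.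
    by rewrite eq_sym (negPf xv) eq_sym (negPf xv').
  have rE := @reattach_relabel V V m x y es mx.
  rewrite -(ler_pM2l (pos _ (reattach x y es))) Er//.
  have := Er (m x) (m y) (relabel m es) mxy; rewrite rE size_map big_map => ->.
  rewrite big_seq [leRHS]big_seq; apply: ler_sum => es' r.
  by rewrite IH// (size_reattach_mem r).
(* Since [m i] and [m j] differ, [i] and [j] cannot both lie in the merged pair; if [i] does, the
   edge is flipped. *)
have [iv|iv] := boolP ((i != v) && (i != v')).
  by case/andP: iv => *; exact: free.
rewrite [leLHS]Ef [leRHS]Ef; apply: free; rewrite 1?eq_sym//.
  apply: contraNneq mij => jv; move: iv ij; rewrite negb_and !negbK /m jv.
  by case/orP => /eqP->; rewrite ?eqxx//; case: ifP.
apply: contraNneq mij => jv; move: iv ij; rewrite negb_and !negbK /m jv.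
by case/orP => /eqP->; rewrite ?eqxx//; case: ifP.
Qed.

(* Duplicate the vertices of [es2], which makes the two expectations independent,
   then merge each vertex with its copy. *)
Lemma wick_correlation (N : nat) (E : seq ('I_N * 'I_N) -> R)
    (E2 : seq (('I_N + 'I_N) * ('I_N + 'I_N)) -> R) es1 es2 :
  wick n E -> wick n E2 -> E es1 * E es2 <= E (es1 ++ es2).
Proof.
move=> wE wE2.
rewrite -(wick_relabel es1 (@inl_inj _ 'I_N) wE wE2).
rewrite -(wick_relabel es2 (@inr_inj 'I_N _) wE wE2).
rewrite -(wick_relabel (es1 ++ es2) (@inl_inj _ 'I_N) wE wE2).
rewrite -(@wick_cat _ E2 (fun u => if u is inl _ then true else false))//; last 2 first.
- by rewrite all_map; apply/allP.
- by rewrite all_map; apply/allP.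
(* [m k] merges the first [k] copies with their originals: [m 0] is the disjoint union and [m N] the
   full merge. *)
pose m (k : nat) (u : 'I_N + 'I_N) : 'I_N + 'I_N :=
  if u is inr j then if (j < k)%N then inl j else inr j else u.
pose es := relabel (@inl _ 'I_N) es1 ++ relabel (@inr 'I_N _) es2.
have -> : relabel (@inl _ 'I_N) (es1 ++ es2) = relabel (m N) es.
  rewrite /es /relabel !map_cat -!map_comp; congr (_ ++ _).
  by apply: eq_map => -[a b] /=; rewrite !ltn_ord.
have -> : relabel (@inl _ 'I_N) es1 ++ relabel (@inr 'I_N _) es2 = relabel (m 0) es.
  by rewrite /es /relabel !map_cat -!map_comp.
suff mk k : (k <= N)%N -> E2 (relabel (m 0) es) <= E2 (relabel (m k) es) by exact: mk.
elim: k => // k IH kN; apply: (le_trans (IH (ltnW kN))).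
apply: le_trans (wick_merge (inl (Ordinal kN)) (inr (Ordinal kN)) _ wE2) _.
rewrite /relabel -map_comp (@eq_map _ _ _ (fun e => (m k.+1 e.1, m k.+1 e.2)))//.
suff mS u : (if m k u == inr (Ordinal kN) then inl (Ordinal kN) else m k u) = m k.+1 u.
  by move=> e /=; rewrite !mS.
case: u => //= j; rewrite ltnS [(j <= k)%N]leq_eqVlt.
case: (ltnP j k) => jk; first by rewrite orbT.
rewrite orbF; have [jE|jE] := eqVneq (j : nat) k.
  by rewrite (_ : j = Ordinal kN) ?eqxx//; apply: val_inj.
by case: eqP => // -[jE']; rewrite jE' eqxx in jE.
Qed.

End Wick.

(** * From the moments of a single vertex to the Wick recursion *)

Section WickOfMoments.
Variables (R : realFieldType) (n : nat) (V : finType).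
Variable M : ('I_n -> nat) -> R.
Hypothesis M0 : M (fun=> 0%N) = 1.
Hypothesis Msq : forall a, \sum_k M (fun i => (i == k).*2 + a i)%N = M a.
(** Integration by parts on the sphere. When [a k = 0] the subtraction is truncated, but the factor
    [a k] then vanishes. *)
Hypothesis Mrec : forall a k, (n.-1 + \sum_i a i)%:R * M (fun i => (i == k) + a i)%N
  = (a k)%:R * M (fun i => a i - (i == k))%N.

Implicit Types (h : seq (V * 'I_n)) (es : seq (V * V)).

(** A half-edge [(v, k)] stands for the [k]-th coordinate of the vector at [v]. The product over [v]
    expresses the independence of the vertices. *)
Definition moment h : R := \prod_(v : V) M (fun k => count_mem (v, k) h).

(** Each inner product is expanded over the coordinate shared by its two ends, and [h] accumulates
    the resulting half-edges. *)
Fixpoint graph_moment es h : R :=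
  if es is (i, j) :: es' then \sum_k graph_moment es' [:: (i, k), (j, k) & h]
  else moment h.

Lemma perm_graph_moment es h h' : perm_eq h h' -> graph_moment es h = graph_moment es h'.
Proof.
elim: es h h' => [|[i j] es IH] h h' hh' /=.
  apply: eq_bigr => v _; congr M; apply/funext => k.
  by move/permP: hh'; apply.
by apply: eq_bigr => k _; apply: IH; rewrite !perm_cons.
Qed.

(** Once all the edges are expanded, this is [Msq] at the vertex [v]. *)
Lemma graph_moment_loop es h v :
  \sum_k graph_moment es [:: (v, k), (v, k) & h] = graph_moment es h.
Proof.
elim: es h => [|[i j] es IH] h /=.
  rewrite {2}/moment (bigD1 v)//= -Msq mulr_suml; apply: eq_bigr => k _.
  rewrite /moment (bigD1 v)//=; congr (_ * _).
    congr M; apply/funext => l; rewrite addnA addnn.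
    by rewrite xpair_eqE eqxx eq_sym.
  apply: eq_bigr => u uv; congr M; apply/funext => l.
  by rewrite !xpair_eqE eq_sym (negPf uv).
rewrite exchange_big; apply: eq_bigr => l _; rewrite -IH; apply: eq_bigr => k _.
by apply: perm_graph_moment; rewrite (perm_catCA [:: _; _] [:: _; _]).
Qed.

Lemma graph_moment_flip es h i j :
  graph_moment ((i, j) :: es) h = graph_moment ((j, i) :: es) h.
Proof.
by apply: eq_bigr => k _; apply: perm_graph_moment; rewrite (perm_catCA [:: _] [:: _]).
Qed.

(* [f] applied to the derivative of the monomial [h] with respect to the variable [x]. *)
Let der (f : seq (V * 'I_n) -> R) x h := (count_mem x h)%:R * f (rem x h).

(** The Leibniz rule. *)
Lemma der_cons f x y h : (forall h h', perm_eq h h' -> f h = f h') ->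
  der f x (y :: h) = (y == x)%:R * f h + der (fun h => f (y :: h)) x h.
Proof.
move=> fp; rewrite /der /=; have [->|yx] := eqVneq y x; last by rewrite mul0r !add0r.
rewrite natrD mulrDl mul1r; congr (_ + _).
have [xh|xh] := boolP (x \in h); last by rewrite (count_memPn xh) !mul0r.
by congr (_ * _); apply: fp; exact: perm_to_rem.
Qed.

(* The part of the derivative in the [k]-th coordinate of [v] that falls on the edges. *)
Fixpoint graph_der (v : V) (k : 'I_n) es h : R :=
  if es is (i, j) :: es' then
    (i == v)%:R * graph_moment es' ((j, k) :: h)
    + (j == v)%:R * graph_moment es' ((i, k) :: h)
    + \sum_l graph_der v k es' [:: (i, l), (j, l) & h]
  else 0.

Lemma perm_graph_der v k es h h' : perm_eq h h' -> graph_der v k es h = graph_der v k es h'.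
Proof.
elim: es h h' => [|[i j] es IH] h h' hh' //=.
have gp a : graph_moment es ((a, k) :: h) = graph_moment es ((a, k) :: h').
  by apply: perm_graph_moment; rewrite perm_cons.
rewrite !gp.
by congr (_ + _); apply: eq_bigr => l _; apply: IH; rewrite !perm_cons.
Qed.

(** Only the factor at [v] changes, and [Mrec] applies to it; the [count] is the degree of [h] at
    [v]. *)
Lemma moment_rec v k h :
  (n.-1 + count (fun x => x.1 == v) h)%:R * moment ((v, k) :: h) = der moment (v, k) h.
Proof.
have -> : count (fun x => x.1 == v) h = (\sum_i count_mem (v, i) h)%N.
  elim: h => [|[u l] h IH] /=; first by rewrite big1.
  rewrite IH big_split/=; congr (_ + _)%N; have [->|uv] := eqVneq u v.
    rewrite (bigD1 l)//= eqxx big1// => i il.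
    by rewrite xpair_eqE eq_sym (negPf il) andbF.
  by rewrite big1// => i _; rewrite xpair_eqE (negPf uv).
rewrite /moment /der (bigD1 v)//= mulrA.
rewrite (_ : M _ = M (fun i => (i == k) + count_mem (v, i) h)%N); last first.
  by congr M; apply/funext => i; rewrite xpair_eqE eqxx eq_sym.
rewrite Mrec [in RHS](bigD1 v)//= mulrA.
have [kh|kh] := boolP ((v, k) \in h); last by rewrite (count_memPn kh) !mul0r.
congr (_ * _ * _).
  by congr M; apply/funext => i; rewrite count_mem_rem/= xpair_eqE eqxx eq_sym.
apply: eq_bigr => u uv; congr M; apply/funext => i.
by rewrite count_mem_rem/= xpair_eqE eq_sym (negPf uv) subn0.
Qed.

(** [moment_rec] with part of the monomial still packed into edges. Expanding an edge adds two
    half-edges to [h], whose Leibniz terms survive only for the coordinate [k] and become the edge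
    terms of [graph_der]. *)
Lemma graph_moment_rec v k es h :
  (n.-1 + (\sum_(e <- es) ((e.1 == v) + (e.2 == v)) + count (fun x => x.1 == v) h))%:R
    * graph_moment es ((v, k) :: h)
  = graph_der v k es h + der (graph_moment es) (v, k) h.
Proof.
elim: es h => [|[i j] es IH] h /=; first by rewrite big_nil add0n add0r -moment_rec.
have gp := @perm_graph_moment es.
rewrite big_cons mulr_sumr /=.
transitivity (\sum_l (graph_der v k es [:: (i, l), (j, l) & h]
    + der (graph_moment es) (v, k) [:: (i, l), (j, l) & h])).
  apply: eq_bigr => l _; rewrite -IH /=; congr (_%:R * _); first lia.
  by apply: gp; rewrite (perm_catCA [:: _; _] [:: _]).
rewrite big_split /= [RHS]addrAC [RHS]addrC; congr (_ + _).
have dE l : der (graph_moment es) (v, k) [:: (i, l), (j, l) & h] =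
    ((i, l) == (v, k))%:R * graph_moment es ((j, l) :: h) + (((j, l) == (v, k))%:R
    * graph_moment es ((i, l) :: h)
    + der (fun h => graph_moment es [:: (i, l), (j, l) & h]) (v, k) h).
  rewrite der_cons//; congr (_ + _); rewrite der_cons//.
  by move=> ? ? ?; apply: gp; rewrite perm_cons.
rewrite (eq_bigr _ (fun l _ => dE l)).
rewrite 2!big_split /= addrA; congr (_ + _); last first.
  by rewrite /der mulr_sumr.
have pick a b : \sum_(l < n) (((a, l) : V * 'I_n) == (v, k))%:R * graph_moment es ((b, l) :: h)
    = (a == v)%:R * graph_moment es ((b, k) :: h).
  rewrite (bigD1 k)//= xpair_eqE eqxx andbT big1 ?addr0// => l lk.
  by rewrite xpair_eqE (negPf lk) andbF mul0r.
by congr (_ + _); exact: pick.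
Qed.

(** Differentiating the inner product of [v] and [j] in the [k]-th coordinate of [v] leaves the
    [k]-th coordinate of [j]; paired with that of [w] and summed over [k], it becomes the inner
    product of [w] and [j]. *)
Lemma graph_der_reattach v w es h :
  \sum_k graph_der v k es ((w, k) :: h) = \sum_(es' <- reattach v w es) graph_moment es' h.
Proof.
elim: es h => [|[i j] es IH] h /=; first by rewrite big_nil big1.
rewrite !big_cat !big_split /= addrA; congr (_ + _ + _).
- case: (i == v); rewrite ?big_cons ?big_nil/=.
    rewrite addr0; apply: eq_bigr => k _; rewrite mul1r.
    by apply: perm_graph_moment; rewrite (perm_catCA [:: _] [:: _]).
  by rewrite big1// => k _; rewrite mul0r.
- case: (j == v); rewrite ?big_cons ?big_nil/=.
    by rewrite addr0; apply: eq_bigr => k _; rewrite mul1r.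
  by rewrite big1// => k _; rewrite mul0r.
rewrite exchange_big big_map /= [RHS]exchange_big; apply: eq_bigr => l _.
rewrite -IH; apply: eq_bigr => k _.
by apply: perm_graph_der; rewrite (perm_catCA [:: _; _] [:: _]).
Qed.

Lemma wick_graph_moment : wick n (graph_moment^~ [::]).
Proof.
split=> [|v es|i j es|i j es ij] /=.
- by rewrite /moment big1.
- exact: graph_moment_loop.
- exact: graph_moment_flip.
- have -> : size (reattach i j es) = (\sum_(e <- es) ((e.1 == i) + (e.2 == i)))%N.
    elim: es => [|[a b] es IH]; first by rewrite big_nil.
    by rewrite big_cons /= !size_cat !size_nseq size_map IH addnA.
  rewrite -graph_der_reattach mulr_sumr; apply: eq_bigr => k _.
  (* The half-edge [(j, k)] contributes neither degree nor derivative at [i], because [i != j]. *)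
  have := graph_moment_rec i k es [:: (j, k)].
  by rewrite /der /= !xpair_eqE eq_sym (negPf ij) /= !addn0 mul0r addr0.
Qed.

End WickOfMoments.

(** * Plane rotations and Lebesgue measure *)

Section OneVariable.
Context {R : realType}.
Local Notation mu := (@lebesgue_measure R).
Local Notation I := (`[(-1 : R), 1]%classic : set R).
Local Notation int1 := (Rintegral mu I).

Definition bounded_by T (C : R) (f : T -> R) := forall x, `|f x| <= C.

Lemma itv11_measure : (mu I = 2%:E)%E.
Proof.
rewrite lebesgue_measure_itv/= lte_fin ifT; last by lra.
by rewrite -EFinB; congr EFin; lra.
Qed.

Lemma bounded_by_near d (T : measurableType d) C (f : T -> R) (A : set T) :
  bounded_by C f -> [bounded f x | x in A].
Proof.
move=> fC; exists C; split; first by rewrite num_real.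
by move=> M CM x _; exact: le_trans (fC x) (ltW CM).
Qed.

Lemma integrable_int1 C (f : R -> R) : measurable_fun setT f -> bounded_by C f ->
  mu.-integrable I (EFin \o f).
Proof.
move=> mf fC; apply: measurable_bounded_integrable => //.
- by rewrite [X in (X < _)%E](itv11_measure) ltry.
- exact: measurable_funTS.
- exact: bounded_by_near fC.
Qed.

Lemma int1D C1 C2 (f g : R -> R) : measurable_fun setT f -> bounded_by C1 f ->
  measurable_fun setT g -> bounded_by C2 g ->
  int1 (fun x => f x + g x) = int1 f + int1 g.
Proof. by move=> *; apply: RintegralD => //; apply: integrable_int1; eassumption. Qed.

Lemma int1Z C (f : R -> R) r : measurable_fun setT f -> bounded_by C f ->
  int1 (fun x => r * f x) = r * int1 f.
Proof. by move=> *; apply: RintegralZl => //; apply: integrable_int1; eassumption. Qed.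

Lemma int1_le C (f : R -> R) : measurable_fun setT f -> bounded_by C f ->
  `|int1 f| <= 2 * C.
Proof.
move=> mf fC; have C0 : 0 <= C by exact: le_trans (fC 0).
apply: le_trans (le_normr_Rintegral _ (integrable_int1 mf fC)) _ => //.
have -> : 2 * C = int1 (fun=> C) by rewrite Rintegral_cst// [X in fine X](itv11_measure)/= mulrC.
apply: le_Rintegral => //.
- have := @integrable_int1 C (fun x => `|f x|); apply; first exact: measurableT_comp.
  by move=> x; rewrite normr_id.
- by apply: (@integrable_int1 C) => // x; rewrite ger0_norm.
Qed.

(** The integral is the difference of those of the positive and negative parts, each measurable in
    [t] by Tonelli. *)
Lemma measurable_int1 d (T : measurableType d) (f : T * R -> R) :
  measurable_fun setT f -> measurable_fun setT (fun t => int1 (fun x => f (t, x))).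
Proof.
move=> mf; apply: (measurableT_comp (@fine_measurable R setT measurableT)).
pose g (z : T * R) := (f z * \1_I z.2)%:E.
have mg : measurable_fun setT g.
  apply/measurable_EFinP/measurable_funM => //.
  by apply: measurableT_comp => //; exact: measurable_indic.
rewrite (_ : (fun _ => _) = (fun t => \int[mu]_x g^\+ (t, x) - \int[mu]_x g^\- (t, x))%E).
  apply: emeasurable_funB.
    by apply: (measurable_fun_fubini_tonelli_F (m2 := mu) (g^\+)%E) => //;
      exact: measurable_funepos.
  by apply: (measurable_fun_fubini_tonelli_F (m2 := mu) (g^\-)%E) => //; exact: measurable_funeneg.
apply/funext => t; rewrite integral_mkcond.
rewrite (_ : _ \_ I = g \o pair t); last first.
  by apply/funext => x; rewrite patchE /g /= indicE; case: ifPn => xI; rewrite ?mulr1 ?mulr0.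
by rewrite integralE funepos_comp funeneg_comp.
Qed.

End OneVariable.

Section TwoVariables.
Context {R : realType}.
Local Notation mu := (@lebesgue_measure R).
Local Notation I := (`[(-1 : R), 1]%classic : set R).
Local Notation int1 := (Rintegral mu I).
Local Notation mu2 := (mu \x mu)%E.

Variables (C : R) (H : R * R -> R).
Hypotheses (mH : measurable_fun setT H) (bH : bounded_by C H).

Let K : R * R -> \bar R := (EFin \o H) \_ (I `*` I).

Let integrable_square : mu2.-integrable setT K.
Proof.
apply/(integrable_mkcond _ _).1; first exact: measurableX.
apply: measurable_bounded_integrable.
- exact: measurableX.
- by rewrite /= product_measure1E// [X in (X * X)%E](itv11_measure) -EFinM ltry.
- exact: measurable_funTS.
- exact: bounded_by_near bH.
Qed.

Let sectionl x : measurable_fun setT (fun y => H (x, y)).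
Proof. exact: measurableT_comp. Qed.

Let sectionr y : measurable_fun setT (fun x => H (x, y)).
Proof. exact: measurableT_comp. Qed.

Lemma int1_int1_prod : int1 (fun x => int1 (fun y => H (x, y)))
  = fine (\int[mu2]_(z in I `*` I) (H z)%:E)%E.
Proof.
rewrite [in RHS]integral_mkcond -(integral12_prod_meas1 integrable_square).
rewrite /Rintegral integral_mkcond; congr fine; apply: eq_integral => x _.
rewrite /fubini_F patchE; case: ifPn => xI.
  rewrite fineK.
    rewrite [LHS]integral_mkcond; apply: eq_integral => y _; rewrite /K !patchE.
    by rewrite in_setX xI.
  by apply: integrable_fin_num => //; apply: (@integrable_int1 _ C) => // y.
rewrite integral0_eq// => y _; rewrite /K patchE in_setX (negPf xI)//.
Qed.

Lemma int1_int1_swap_prod : int1 (fun y => int1 (fun x => H (x, y)))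
  = fine (\int[mu2]_(z in I `*` I) (H z)%:E)%E.
Proof.
rewrite [in RHS]integral_mkcond -(integral21_prod_meas1 integrable_square).
rewrite /Rintegral integral_mkcond; congr fine; apply: eq_integral => y _.
rewrite /fubini_G patchE; case: ifPn => yI.
  rewrite fineK.
    rewrite [LHS]integral_mkcond; apply: eq_integral => x _; rewrite /K !patchE.
    by rewrite in_setX yI andbT.
  by apply: integrable_fin_num => //; apply: (@integrable_int1 _ C) => // x.
rewrite integral0_eq// => x _; rewrite /K patchE in_setX (negPf yI) andbF//.
Qed.

Lemma int1_swap : int1 (fun x => int1 (fun y => H (x, y)))
  = int1 (fun y => int1 (fun x => H (x, y))).
Proof. by rewrite int1_int1_prod int1_int1_swap_prod. Qed.

(** The square contains the unit disc, so for such [H] it can be replaced by the whole plane, a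
    domain invariant under rotations. *)
Lemma int1_int1_disc : (forall z, 1 < z.1 ^+ 2 + z.2 ^+ 2 -> H z = 0) ->
  int1 (fun x => int1 (fun y => H (x, y))) = fine (\int[mu2]_z (H z)%:E)%E.
Proof.
move=> H0; rewrite int1_int1_prod integral_mkcond; congr fine.
apply: eq_integral => -[x y] _; rewrite patchE; case: ifPn => //=.
rewrite in_setX/= negb_and !mem_setE !in_itv/= => xy; rewrite H0//=.
have := sqr_ge0 x; have := sqr_ge0 y.
by case/orP: xy; rewrite negb_and -!ltNge => /orP[] ? ? ?; nra.
Qed.

End TwoVariables.

(** * Rotation invariance of Lebesgue measure in the plane *)

Section Rotation.
Context {R : realType}.
Local Notation mu := (@lebesgue_measure R).
Local Notation mu2 := (mu \x mu)%E.
Local Open Scope ereal_scope.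

Lemma ge0_integral_translation (f : R -> \bar R) (c : R) :
  measurable_fun setT f -> (forall x, 0 <= f x) ->
  \int[mu]_x f (x + c)%R = \int[mu]_x f x.
Proof.
move=> mf f0.
pose phi : measurableTypeR R -> measurableTypeR R := fun x => (x + c)%R.
have mphi : measurable_fun setT phi by exact: measurable_funD.
have := @ge0_integral_pushforward _ _ _ _ _ phi mphi mu setT f measurableT mf (fun x _ => f0 x).
rewrite preimage_setT => <-; apply: eq_measure_integral => A mA _.
(* The image of Lebesgue measure under the translation agrees with it on half-open intervals. *)
apply/esym/lebesgue_measure_unique => //= _ [[a b]] _ <-.
rewrite /pushforward (_ : phi @^-1` _ = `](a - c)%R, (b - c)%R]%classic); last first.
  by apply/seteqP; split => x /=; rewrite !in_itv/= ltrBlDr lerBrDr.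
rewrite !lebesgue_measure_itv/= !lte_fin ltrD2r; case: ifPn => // _.
by rewrite -!EFinB; congr EFin; ring.
Qed.

(** By Tonelli, a shear is a translation on each horizontal line. *)
Lemma ge0_integral_shear1 (f : R * R -> \bar R) (t : R) :
  measurable_fun setT f -> (forall x, 0 <= f x) ->
  \int[mu2]_z f (z.1 + t * z.2, z.2)%R = \int[mu2]_z f z.
Proof.
move=> mf f0; rewrite !fubini_tonelli2//; last first.
  apply: measurableT_comp => //; apply: measurable_fun_pair => //.
  by apply: measurable_funD => //; exact: measurable_funM.
apply: eq_integral => y _; rewrite /fubini_G/=.
apply: (ge0_integral_translation (f := fun x => f (x, y))) => //.
exact: measurableT_comp.
Qed.

Lemma ge0_integral_shear2 (f : R * R -> \bar R) (t : R) :
  measurable_fun setT f -> (forall x, 0 <= f x) ->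
  \int[mu2]_z f (z.1, z.2 + t * z.1)%R = \int[mu2]_z f z.
Proof.
move=> mf f0; rewrite !fubini_tonelli1//; last first.
  apply: measurableT_comp => //; apply: measurable_fun_pair => //.
  by apply: measurable_funD => //; exact: measurable_funM.
apply: eq_integral => x _; rewrite /fubini_F/=.
apply: (ge0_integral_translation (f := fun y => f (x, y))) => //.
exact: measurableT_comp.
Qed.

Definition rotation (c s : R) (z : R * R) : R * R :=
  (c * z.1 + s * z.2, c * z.2 - s * z.1)%R.

(* A rotation is a product of three shears. *)
Lemma ge0_integral_rotation (f : R * R -> \bar R) (c s : R) :
  (c ^+ 2 + s ^+ 2 = 1)%R -> (0 < c)%R ->
  measurable_fun setT f -> (forall x, 0 <= f x) ->
  \int[mu2]_z f (rotation c s z) = \int[mu2]_z f z.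
Proof.
(* [a] is the tangent of the half-angle; the three shears have parameters [a], [- s] and [a]. *)
move=> cs c0 mf f0; pose a := (s / (1 + c))%R.
have c1 : (1 + c != 0)%R by rewrite gt_eqF// addr_gt0.
have mS1 : measurable_fun setT (fun z : R * R => (z.1 + a * z.2, z.2)%R).
  apply: measurable_fun_pair => //.
  by apply: measurable_funD => //; exact: measurable_funM.
have mS2 : measurable_fun setT (fun z : R * R => (z.1, z.2 + - s * z.1)%R).
  apply: measurable_fun_pair => //.
  by apply: measurable_funD => //; exact: measurable_funM.
pose f1 (z : R * R) := f (z.1 + a * z.2, z.2)%R.
pose f2 (z : R * R) := f1 (z.1, z.2 + - s * z.1)%R.
have mf1 : measurable_fun setT f1 by exact: (measurableT_comp mf mS1).
have mf2 : measurable_fun setT f2 by exact: (measurableT_comp mf1 mS2).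
rewrite -(ge0_integral_shear1 a mf f0) -(ge0_integral_shear2 (- s) mf1 (fun=> f0 _)).
rewrite -(ge0_integral_shear1 a mf2 (fun=> f0 _)).
apply: eq_integral => -[x y] _ /=; rewrite /rotation /f2 /f1/=.
have as1 : (a * s = 1 - c)%R.
  rewrite /a mulrAC; apply: (mulIf c1); rewrite divfK//.
  by rewrite -[X in (X - _)%R]cs -expr2; move: cs; nra.
have ac : (a * (1 + c) = s)%R by rewrite /a divfK.
by congr (f (_, _))%R; [rewrite -{1}ac|]; move: as1; nra.
Qed.

Lemma integral_rotation (f : R * R -> R) (c s : R) :
  (c ^+ 2 + s ^+ 2 = 1)%R -> (0 < c)%R -> measurable_fun setT f ->
  \int[mu2]_z (f (rotation c s z))%:E = \int[mu2]_z (f z)%:E.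
Proof.
move=> cs c0 mf; have mEf : measurable_fun setT (EFin \o f) by exact/measurable_EFinP.
transitivity (\int[mu2]_z (((EFin \o f) \o rotation c s) z)); first by [].
rewrite [LHS]integralE [RHS]integralE funepos_comp funeneg_comp.
congr (_ - _); apply: ge0_integral_rotation => //.
  exact: measurable_funepos.
exact: measurable_funeneg.
Qed.

End Rotation.

(** * Iterated integrals *)

Section IteratedIntegral.
Context {R : realType}.
Local Notation mu := (@lebesgue_measure R).
Local Notation I := (`[(-1 : R), 1]%classic : set R).
Local Notation int1 := (Rintegral mu I).

(** Lets any coordinate, not just the first, be pulled out of an iterated integral. *)
Fixpoint insert (j : nat) (x : R) (s : seq R) : seq R :=
  if j is j'.+1 then if s is y :: s' then y :: insert j' x s' else [:: x] else x :: s.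

Lemma nth_insert j x s : (j <= size s)%N -> nth 0 (insert j x s) j = x.
Proof. by elim: j s => [|j IH] [|y s]//= ?; rewrite IH. Qed.

Lemma nth_insert_bump j x s i :
  (j <= size s)%N -> nth 0 (insert j x s) (bump j i) = nth 0 s i.
Proof.
elim: j s i => [|j IH] [|y s] [|i]//= js; rewrite /bump/=.
by rewrite ltnS addnS/= -(IH s i).
Qed.

(* Joint measurability of [F t s] in [t] and in the [k] entries of [s]. *)
Fixpoint seq_measurable (k : nat) d (T : measurableType d) (F : T -> seq R -> R) : Prop :=
  if k is k'.+1 then @seq_measurable k' _ (T * R)%type (fun tx s => F tx.1 (tx.2 :: s))
  else measurable_fun setT (F^~ [::]).

Lemma seq_measurable_param k d (T : measurableType d) d' (T' : measurableType d')
    (phi : T' -> T) (F : T -> seq R -> R) :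
  measurable_fun setT phi -> seq_measurable k F -> seq_measurable k (fun t => F (phi t)).
Proof.
elim: k d T d' T' phi F => [|k IH] d T d' T' phi F mphi /= mF.
  exact: (measurableT_comp mF mphi).
apply: (IH _ _ _ _ (fun tx : T' * R => (phi tx.1, tx.2)) _ _ mF).
by apply: measurable_fun_pair => //; exact: measurableT_comp.
Qed.

Lemma seq_measurable_cst k d (T : measurableType d) (f : T -> R) :
  measurable_fun setT f -> seq_measurable k (fun t _ => f t).
Proof.
elim: k d T f => [|k IH] d T f mf //=.
by apply: (IH _ _ (fun tx : T * R => f tx.1)); exact: measurableT_comp.
Qed.

Lemma seq_measurable_nth k d (T : measurableType d) i :
  seq_measurable k (fun (_ : T) s => nth 0 s i).
Proof.
elim: k d T i => [|k IH] d T [|i] //=; first exact: seq_measurable_cst.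
exact: IH.
Qed.

Lemma seq_measurable_comp k d (T : measurableType d) (h : R -> R) F :
  measurable_fun setT h -> seq_measurable k F -> seq_measurable k (fun (t : T) s => h (F t s)).
Proof.
move=> mh; elim: k d T F => [|k IH] d T F /= mF; first exact: measurableT_comp.
exact: IH mF.
Qed.

Lemma seq_measurable_op k d (T : measurableType d) (h : R * R -> R) F G :
  measurable_fun setT h -> seq_measurable k F -> seq_measurable k G ->
  seq_measurable k (fun (t : T) s => h (F t s, G t s)).
Proof.
move=> mh; elim: k d T F G => [|k IH] d T F G /= mF mG; last exact: (IH _ _ _ _ mF mG).
by apply: (measurableT_comp mh); exact: measurable_fun_pair.
Qed.

Lemma seq_measurableD k d (T : measurableType d) F G :
  seq_measurable k F -> seq_measurable k G ->
  seq_measurable k (fun (t : T) s => F t s + G t s).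
Proof.
apply: (@seq_measurable_op k d T (fun z => z.1 + z.2)).
exact: measurable_funD.
Qed.

Lemma seq_measurableM k d (T : measurableType d) F G :
  seq_measurable k F -> seq_measurable k G ->
  seq_measurable k (fun (t : T) s => F t s * G t s).
Proof.
apply: (@seq_measurable_op k d T (fun z => z.1 * z.2)).
exact: measurable_funM.
Qed.

Lemma seq_measurable_sum k d (T : measurableType d) (J : Type) (r : seq J) F :
  (forall i, seq_measurable k (F i)) ->
  seq_measurable k (fun (t : T) s => \sum_(i <- r) F i t s).
Proof.
move=> mF; elim: r => [|i r IH].
  under eq_fun do under eq_fun do rewrite big_nil.
  exact: seq_measurable_cst.
under eq_fun do under eq_fun do rewrite big_cons.
exact: seq_measurableD.
Qed.

Lemma seq_measurable_prod k d (T : measurableType d) (J : Type) (r : seq J) F :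
  (forall i, seq_measurable k (F i)) ->
  seq_measurable k (fun (t : T) s => \prod_(i <- r) F i t s).
Proof.
move=> mF; elim: r => [|i r IH].
  under eq_fun do under eq_fun do rewrite big_nil.
  exact: seq_measurable_cst.
under eq_fun do under eq_fun do rewrite big_cons.
exact: seq_measurableM.
Qed.

Lemma seq_measurable_insert k d (T : measurableType d) j (F : T -> seq R -> R) :
  (j <= k)%N -> seq_measurable k.+1 F ->
  seq_measurable k (fun (tx : T * R) s => F tx.1 (insert j tx.2 s)).
Proof.
elim: k j d T F => [|k IH] [|j] d T F // jk mF.
(* The induction hypothesis takes the head of the list before the inserted entry and the goal takes
   them in the other order, hence the swap [sw]. *)
have := IH j _ (T * R)%type (fun tx s => F tx.1 (tx.2 :: s)) jk mF.
pose sw (z : T * R * R) := (z.1.1, z.2, z.1.2).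
have msw : measurable_fun setT sw.
  by apply: measurable_fun_pair; [apply: measurable_fun_pair|] => //; exact: measurableT_comp.
exact: (seq_measurable_param msw).
Qed.

Lemma measurable_iter_int k d (T : measurableType d) (F : T -> seq R -> R) :
  seq_measurable k F -> measurable_fun setT (fun t => iter_int k (F t)).
Proof.
elim: k d T F => [|k IH] d T F //= mF.
exact: (measurable_int1 (IH _ _ _ mF)).
Qed.

Lemma eq_iter_int k (F G : seq R -> R) :
  (forall s, size s = k -> F s = G s) -> iter_int k F = iter_int k G.
Proof.
elim: k F G => [|k IH] F G FG /=; first exact: FG.
by apply: eq_Rintegral => x _; apply: IH => s sk; rewrite FG//= sk.
Qed.

Lemma iter_int0 k : iter_int k (fun=> 0 : R) = 0.
Proof.
elim: k => //= k IH; under eq_Rintegral do rewrite IH.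
by rewrite Rintegral_cst// mul0r.
Qed.

Lemma iter_int_bounded k d (T : measurableType d) C (F : T -> seq R -> R) :
  seq_measurable k F -> (forall t s, `|F t s| <= C) ->
  bounded_by (2 ^+ k * C) (fun t => iter_int k (F t)).
Proof.
elim: k d T F => [|k IH] d T F /= mF FC t; first by rewrite mul1r.
have mi := measurable_iter_int mF.
rewrite exprS -mulrA; apply: int1_le.
  exact: (measurableT_comp mi (pair1_measurable t)).
move=> x; exact: (IH _ _ _ mF (fun _ _ => FC _ _) (t, x)).
Qed.

(** The parameter [t] collects the variables of the outer integrals, so that the induction has the
    joint measurability it requires. *)
Lemma iter_intD k d (T : measurableType d) C1 C2 (F G : T -> seq R -> R) t :
  seq_measurable k F -> (forall t s, `|F t s| <= C1) ->
  seq_measurable k G -> (forall t s, `|G t s| <= C2) ->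
  iter_int k (fun s => F t s + G t s) = iter_int k (F t) + iter_int k (G t).
Proof.
elim: k d T F G t => [|k IH] d T F G t //= mF FC mG GC.
under eq_Rintegral do rewrite (IH _ _ _ _ (t, _) mF (fun _ _ => FC _ _) mG (fun _ _ => GC _ _)).
apply: (int1D (C1 := 2 ^+ k * C1) (C2 := 2 ^+ k * C2)).
- exact: (measurableT_comp (measurable_iter_int mF) (pair1_measurable t)).
- move=> x; exact: (iter_int_bounded mF (fun _ _ => FC _ _) (t, x)).
- exact: (measurableT_comp (measurable_iter_int mG) (pair1_measurable t)).
- move=> x; exact: (iter_int_bounded mG (fun _ _ => GC _ _) (t, x)).
Qed.

Lemma iter_intZ k d (T : measurableType d) C (F : T -> seq R -> R) r t :
  seq_measurable k F -> (forall t s, `|F t s| <= C) ->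
  iter_int k (fun s => r * F t s) = r * iter_int k (F t).
Proof.
elim: k d T F t => [|k IH] d T F t //= mF FC.
under eq_Rintegral do rewrite (IH _ _ _ (t, _) mF (fun _ _ => FC _ _)).
apply: (int1Z (C := 2 ^+ k * C)).
- exact: (measurableT_comp (measurable_iter_int mF) (pair1_measurable t)).
- move=> x; exact: (iter_int_bounded mF (fun _ _ => FC _ _) (t, x)).
Qed.

Lemma iter_int_sum k d (T : measurableType d) C (J : Type) (r : seq J)
    (c : J -> R) (F : J -> T -> seq R -> R) t :
  (forall i, seq_measurable k (F i)) -> (forall i t s, `|F i t s| <= C) ->
  iter_int k (fun s => \sum_(i <- r) c i * F i t s) = \sum_(i <- r) c i * iter_int k (F i t).
Proof.
move=> mF FC; elim: r => [|i r IH].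
  by under eq_fun do rewrite big_nil; rewrite big_nil iter_int0.
under eq_fun do rewrite big_cons; rewrite big_cons.
have mcF j : seq_measurable k (fun t s => c j * F j t s).
  by apply: seq_measurableM => //; exact: seq_measurable_cst.
have cFC j u s : `|c j * F j u s| <= `|c j| * C by rewrite normrM ler_wpM2l.
rewrite (iter_intD (F := fun t s => c i * F i t s) (G := fun t s => \sum_(j <- r) c j * F j t s)
   (C1 := `|c i| * C) (C2 := \sum_(j <- r) `|c j| * C))//.
- by rewrite IH (iter_intZ _ _ (mF i) (FC i)).
- exact: seq_measurable_sum.
- by move=> u s; apply: le_trans (ler_norm_sum _ _ _) _; apply: ler_sum.
Qed.

(** Fubini, by induction on [j]: each step exchanges the two outermost integrals. *)
Lemma iter_int_insert k d (T : measurableType d) C j (F : T -> seq R -> R) t :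
  (j <= k)%N -> seq_measurable k.+1 F -> (forall t s, `|F t s| <= C) ->
  iter_int k.+1 (F t) = int1 (fun x => iter_int k (fun s => F t (insert j x s))).
Proof.
elim: k j d T F t => [|k IH] [|j] d T F t // jk mF FC.
have mF' : seq_measurable k.+1 (fun (tx : T * R) s => F tx.1 (tx.2 :: s)) by [].
transitivity (int1 (fun y => int1 (fun x => iter_int k (fun s => F t (y :: insert j x s))))).
  apply: eq_Rintegral => y _.
  exact: (IH j _ _ (fun (tx : T * R) s => F tx.1 (tx.2 :: s)) (t, y) jk mF' (fun _ _ => FC _ _)).
have mG := seq_measurable_insert (j := j) jk mF'.
have mH := measurable_iter_int mG.
pose H (z : R * R) := iter_int k (fun s => F t (z.1 :: insert j z.2 s)).
apply: (@int1_swap _ (2 ^+ k * C) H).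
  have mphi : measurable_fun setT (fun z : R * R => (t, z.1, z.2)).
    by apply: measurable_fun_pair => //; exact: measurable_fun_pair.
  exact: (measurableT_comp mH mphi).
move=> z; exact: (iter_int_bounded mG (fun _ _ => FC _ _) (t, z.1, z.2)).
Qed.

End IteratedIntegral.

(** * Moments of the ball *)

Section BallMoments.
Context {R : realType}.

(* [weight d |x|^2 * p x] is the integrand of a [d]-homogeneous [p] at [x/|x|] over the
   punctured unit ball. *)
Definition weight (d : nat) (q : R) : R :=
  if (0 < q) && (q <= 1) then (Num.sqrt q)^-1 ^+ d else 0.

Lemma measurable_weight d : measurable_fun setT (weight d).
Proof.
(* Rewritten with a real power, whose measurability is known. *)
rewrite (_ : weight d = fun q => if (0 < q) && (q <= 1) then (q `^ (- 2^-1)) ^+ d else 0).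
  apply: measurable_fun_ifT => //.
    by apply: measurable_and; [exact: measurable_fun_ltr|exact: measurable_fun_ler].
  by apply: measurable_funX; exact: measurable_powR.
apply/funext => q; rewrite /weight; case: ifP => // /andP[q0 _].
by rewrite powRN powR12_sqrt// ltW.
Qed.

(** Homogeneity compensates the singularity at the origin: all the integrands below are bounded by
    1, hence integrable on the cube. *)
Lemma weight_bounded d q p : `|p| <= Num.sqrt q ^+ d -> `|weight d q * p| <= 1.
Proof.
move=> pq; rewrite /weight; case: ifP => [/andP[q0 _]|_]; last by rewrite mul0r normr0.
have sq0 : 0 < Num.sqrt q by rewrite sqrtr_gt0.
rewrite exprVn normrM normfV (ger0_norm (exprn_ge0 _ (ltW sq0))).
by rewrite ler_pdivrMl ?mulr1 ?exprn_gt0.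
Qed.

(** The identity |x/|x||^2 = 1 in terms of weights. *)
Lemma weight_sqr d q : weight d.+2 q * q = weight d q.
Proof.
rewrite /weight; case: ifP => [/andP[q0 _]|_]; last by rewrite mul0r.
rewrite -addn2 exprD -mulrA [X in _ * (X * _)]exprVn sqr_sqrtr ?ltW//.
by rewrite mulVf ?mulr1// gt_eqF.
Qed.

Lemma le_norm_sqrt (x q : R) : x ^+ 2 <= q -> `|x| <= Num.sqrt q.
Proof. by move=> xq; rewrite -sqrtr_sqr ler_sqrt// (le_trans (sqr_ge0 x) xq). Qed.

Definition sqnorm n (s : seq R) : R := \sum_(i < n) nth 0 s i ^+ 2.

Definition monom n (a : 'I_n -> nat) (s : seq R) : R := \prod_(i < n) nth 0 s i ^+ a i.

Lemma sqnorm_ge0 n s : 0 <= sqnorm n s.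
Proof. by apply: sumr_ge0 => i _; exact: sqr_ge0. Qed.

Lemma monom_bounded n (a : 'I_n -> nat) s q :
  sqnorm n s <= q -> `|monom a s| <= Num.sqrt q ^+ (\sum_i a i).
Proof.
move=> sq; rewrite /monom normr_prod.
rewrite (big_morph (fun e => Num.sqrt q ^+ e) (exprD _) (expr0 _)).
apply: ler_prod => i _; rewrite normr_ge0/= normrX lerXn2r ?nnegrE ?sqrtr_ge0//.
apply: le_norm_sqrt; apply: le_trans sq; rewrite /sqnorm (bigD1 i)//= lerDl.
by apply: sumr_ge0 => j _; exact: sqr_ge0.
Qed.

Lemma sqnorm_insert n (j : 'I_n.+1) x s : size s = n ->
  sqnorm n.+1 (insert j x s) = x ^+ 2 + sqnorm n s.
Proof.
move=> sn; have js : (j <= size s)%N by rewrite sn -ltnS.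
rewrite /sqnorm (bigD1_ord j)//= nth_insert//; congr (_ + _).
by apply: eq_bigr => i _; rewrite nth_insert_bump.
Qed.

Lemma monom_insert n (a : 'I_n.+1 -> nat) (j : 'I_n.+1) x s : size s = n ->
  monom a (insert j x s) = x ^+ a j * monom (fun i => a (lift j i)) s.
Proof.
move=> sn; have js : (j <= size s)%N by rewrite sn -ltnS.
rewrite /monom (bigD1_ord j)//= nth_insert//; congr (_ * _).
by apply: eq_bigr => i _; rewrite nth_insert_bump.
Qed.

Lemma seq_measurable_sqnorm k d (T : measurableType d) n :
  seq_measurable k (fun (_ : T) s => sqnorm n s).
Proof.
apply: seq_measurable_sum => i.
by apply: (seq_measurable_comp (h := fun x => x ^+ 2)) => //; exact: seq_measurable_nth.
Qed.

Lemma seq_measurable_monom k d (T : measurableType d) n (a : 'I_n -> nat) :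
  seq_measurable k (fun (_ : T) s => monom a s).
Proof.
apply: seq_measurable_prod => i.
by apply: (seq_measurable_comp (h := fun x => x ^+ a i)) => //; exact: seq_measurable_nth.
Qed.

End BallMoments.

(** The integral over the unit ball of the monomial with exponents [a] at x/|x|, not yet divided by
    the volume. *)
HB.lock Definition ball_moment {R : realType} {n : nat} (a : 'I_n -> nat) : R :=
  iter_int n (fun s => weight (\sum_i a i) (sqnorm n s) * monom a s).

Section PlaneMoments.
Context {R : realType}.

Definition moment1 n d (a : 'I_n -> nat) (x : R) e s :=
  weight d (x ^+ 2 + sqnorm n s) * (x ^+ e * monom a s).

Definition moment2 n d (a : 'I_n -> nat) (z : R * R) e1 e2 s :=
  weight d (z.1 ^+ 2 + (z.2 ^+ 2 + sqnorm n s)) * (z.1 ^+ e1 * (z.2 ^+ e2 * monom a s)).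

Lemma seq_measurable_moment0 k d (T : measurableType d) n e (a : 'I_n -> nat) :
  seq_measurable k (fun (_ : T) (s : seq R) => weight e (sqnorm n s) * monom a s).
Proof.
apply: seq_measurableM; last exact: seq_measurable_monom.
apply: (seq_measurable_comp (measurable_weight _)); exact: seq_measurable_sqnorm.
Qed.

Lemma seq_measurable_moment1 k n d (a : 'I_n -> nat) e :
  seq_measurable k (fun x : R => moment1 d a x e).
Proof.
apply: seq_measurableM.
  apply: (seq_measurable_comp (measurable_weight _)).
  apply: seq_measurableD; last exact: seq_measurable_sqnorm.
  by apply: (seq_measurable_cst _ (f := fun x : R => x ^+ 2)).
apply: seq_measurableM; last exact: seq_measurable_monom.
by apply: (seq_measurable_cst _ (f := fun x : R => x ^+ e)).
Qed.

Lemma seq_measurable_moment2 k n d (a : 'I_n -> nat) e1 e2 :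
  seq_measurable k (fun z : R * R => moment2 d a z e1 e2).
Proof.
have m1 m : measurable_fun setT (fun z : R * R => z.1 ^+ m) by exact: measurable_funX.
have m2 m : measurable_fun setT (fun z : R * R => z.2 ^+ m) by exact: measurable_funX.
apply: seq_measurableM.
  apply: (seq_measurable_comp (measurable_weight _)).
  apply: seq_measurableD; first exact: (seq_measurable_cst _ (m1 2)).
  apply: seq_measurableD; first exact: (seq_measurable_cst _ (m2 2)).
  exact: seq_measurable_sqnorm.
apply: seq_measurableM; first exact: (seq_measurable_cst _ (m1 e1)).
apply: seq_measurableM; first exact: (seq_measurable_cst _ (m2 e2)).
exact: seq_measurable_monom.
Qed.

Lemma moment1_bounded n d (a : 'I_n -> nat) e :
  (e + \sum_i a i)%N = d -> forall x s, `|moment1 d a x e s| <= 1.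
Proof.
move=> <- x s; apply: weight_bounded; rewrite exprD normrM ler_pM//.
  by rewrite normrX lerXn2r ?nnegrE ?sqrtr_ge0// le_norm_sqrt// lerDl sqnorm_ge0.
by apply: monom_bounded; rewrite lerDr sqr_ge0.
Qed.

Lemma moment2_bounded n d (a : 'I_n -> nat) e1 e2 :
  (e1 + (e2 + \sum_i a i))%N = d -> forall z s, `|moment2 d a z e1 e2 s| <= 1.
Proof.
move=> <- z s; have := sqnorm_ge0 n s; have := sqr_ge0 z.1; have := sqr_ge0 z.2 => *.
apply: weight_bounded; rewrite exprD normrM ler_pM//.
  by rewrite normrX lerXn2r ?nnegrE ?sqrtr_ge0// le_norm_sqrt//; lra.
rewrite exprD normrM ler_pM//.
  by rewrite normrX lerXn2r ?nnegrE ?sqrtr_ge0// le_norm_sqrt//; lra.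
by apply: monom_bounded; lra.
Qed.

End PlaneMoments.

(** The coordinates of the plane are outermost, so that the inner integral is a function on the
    plane, ready to be rotated. *)
HB.lock Definition plane_moment {R : realType} {n : nat} (a : 'I_n -> nat) (e1 e2 : nat) : R :=
  iter_int 2 (fun s => iter_int n
    (moment2 (e1 + (e2 + \sum_i a i)) a (nth 0 s 0, nth 0 s 1) e1 e2)).

Section PlaneRotation.
Context {R : realType}.
Local Notation mu := (@lebesgue_measure R).
Local Notation I := (`[(-1 : R), 1]%classic : set R).
Local Notation int1 := (Rintegral mu I).

Lemma sum_lift n (a : 'I_n.+2 -> nat) (j : 'I_n.+2) (k : 'I_n.+1) :
  (\sum_i a i = a j + (a (lift j k) + \sum_i a (lift j (lift k i))))%N.
Proof. by rewrite (bigD1_ord j)//= (bigD1_ord k). Qed.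

Lemma ball_moment_plane n (a : 'I_n.+2 -> nat) (j : 'I_n.+2) (k : 'I_n.+1) :
  ball_moment a = plane_moment (fun i => a (lift j (lift k i))) (a j) (a (lift j k)) :> R.
Proof.
rewrite ball_moment.unlock plane_moment.unlock -sum_lift; set d := (\sum_i a i)%N.
have dE : (a j + \sum_i a (lift j i))%N = d by rewrite /d (bigD1_ord j).
pose F (_ : unit) (s : seq R) := weight d (sqnorm n.+2 s) * monom a s.
have mF : seq_measurable n.+2 F by exact: seq_measurable_moment0.
have FC t s : `|F t s| <= 1 by apply: weight_bounded; exact: monom_bounded.
rewrite (iter_int_insert tt (_ : (j <= n.+1)%N) mF FC) -1?ltnS//.
apply: eq_Rintegral => x _.
transitivity (iter_int n.+1 (moment1 d (fun i => a (lift j i)) x (a j))).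
  apply: eq_iter_int => s sn; rewrite /F /moment1.
  by rewrite sqnorm_insert// monom_insert.
rewrite (@iter_int_insert R n _ R 1 k (fun x => moment1 d _ x (a j)) x (_ : (k <= n)%N)
  (seq_measurable_moment1 _ _ _ _) (moment1_bounded dE)) -1?ltnS//.
apply: eq_Rintegral => y _.
apply: eq_iter_int => s sn; rewrite /moment1 /moment2.
by rewrite sqnorm_insert// monom_insert.
Qed.

(** Rotation by the angle of tangent [t] turns the [e]-th power of the first coordinate into that of
    c (x + t y), which is expanded by the binomial formula. *)
Lemma plane_moment_rotation n (a : 'I_n -> nat) (e : nat) (t : R) :
  \sum_(i < e.+1) ('C(e, i))%:R * t ^+ i * plane_moment a (e - i) i
  = Num.sqrt (1 + t ^+ 2) ^+ e * plane_moment a e 0.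
Proof.
pose d := (e + \sum_i a i)%N.
pose H i (z : R * R) := iter_int n (moment2 d a z (e - i) i).
have dE i : (i <= e)%N -> (e - i + (i + \sum_i a i))%N = d by rewrite /d; lia.
have mH i : measurable_fun setT (H i).
  exact: (measurable_iter_int (seq_measurable_moment2 _ _ _ _ _)).
have bH i : (i <= e)%N -> bounded_by (2 ^+ n * 1) (H i).
  move=> ie; apply: (iter_int_bounded (seq_measurable_moment2 _ _ _ _ _)).
  by apply: moment2_bounded; exact: dE.
have H0 i z : 1 < z.1 ^+ 2 + z.2 ^+ 2 -> H i z = 0.
  move=> z1; rewrite /H -[RHS](iter_int0 n); apply: eq_iter_int => s _.
  rewrite /moment2 /weight ifF ?mul0r//; apply/negbTE; rewrite negb_and -!ltNge.
  by have := sqnorm_ge0 n s => ?; apply/orP; right; lra.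
have HE i : (i <= e)%N -> plane_moment a (e - i) i
    = fine (\int[(mu \x mu)%E]_z (H i z)%:E)%E.
  move=> ie; rewrite plane_moment.unlock dE//.
  exact: (int1_int1_disc (mH i) (bH i ie) (H0 i)).
(* The cosine of the angle of tangent [t]; its sine is [t * c]. *)
pose c := (Num.sqrt (1 + t ^+ 2))^-1.
have t0 : 0 < 1 + t ^+ 2 by have := sqr_ge0 t; lra.
have c0 : 0 < c by rewrite invr_gt0 sqrtr_gt0.
have c2 : c ^+ 2 * (1 + t ^+ 2) = 1.
  by rewrite exprVn sqr_sqrtr ?ltW// mulVf// gt_eqF.
have cs : c ^+ 2 + (t * c) ^+ 2 = 1 by rewrite -c2; ring.
(* The weight depends only on the norm, which the rotation preserves. *)
have Hrot z : H 0%N (rotation c (t * c) z)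
    = \sum_(i < e.+1) (c ^+ e * 'C(e, i)%:R * t ^+ i) * H i z.
  have := @iter_int_sum R n _ (R * R)%type 1 _ (index_enum 'I_e.+1)
     (fun i => c ^+ e * 'C(e, i)%:R * t ^+ i) (fun i z => moment2 d a z (e - i) i) z.
  rewrite /H => <-; last 2 first.
  - by move=> i; exact: seq_measurable_moment2.
  - by move=> i; apply: moment2_bounded; apply: dE; rewrite -ltnS.
  apply: eq_iter_int => s _; rewrite /moment2 /rotation/=.
  transitivity (weight d (z.1 ^+ 2 + (z.2 ^+ 2 + sqnorm n s))
      * ((c * z.1 + t * c * z.2) ^+ e * monom a s)).
    congr (weight d _ * _); last by rewrite subn0 expr0 mul1r.
    rewrite addrA [RHS]addrA; congr (_ + _).
    by rewrite -[RHS]mul1r -cs; ring.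
  rewrite (_ : c * z.1 + t * c * z.2 = c * (z.1 + t * z.2)); last by ring.
  rewrite exprMn exprDn mulr_sumr mulr_suml mulr_sumr.
  apply: eq_bigr => i _; rewrite exprMn -mulr_natl; ring.
have bHi (i : 'I_e.+1) : bounded_by (2 ^+ n * 1) (H i) by apply: bH; rewrite -ltnS.
have rot : fine (\int[(mu \x mu)%E]_z (H 0 (rotation c (t * c) z))%:E)%E
    = \sum_(i < e.+1) (c ^+ e * 'C(e, i)%:R * t ^+ i) * plane_moment a (e - i) i.
  have mR : measurable_fun setT (rotation c (t * c)).
    by apply: measurable_fun_pair; [apply: measurable_funD|apply: measurable_funB];
      exact: measurable_funM.
  rewrite -(int1_int1_disc (C := 2 ^+ n * 1) (H := H 0%N \o rotation c (t * c))); first last.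
  - move=> z z1; apply: H0; rewrite /rotation/=.
    rewrite (_ : _ + _ = (c ^+ 2 + (t * c) ^+ 2) * (z.1 ^+ 2 + z.2 ^+ 2)); last by ring.
    by rewrite cs mul1r.
  - by move=> z; exact: (bH 0%N).
  - exact: (measurableT_comp (mH 0%N) mR).
  pose G i (_ : unit) (s : seq R) := H i (nth 0 s 0, nth 0 s 1).
  have mG i : seq_measurable 2 (G i).
    have mp : measurable_fun setT (fun w : unit * R * R => (w.1.2, w.2)).
      by apply: measurable_fun_pair => //; exact: measurableT_comp.
    exact: (measurableT_comp (mH i) mp).
  have := @iter_int_sum R 2 _ unit (2 ^+ n * 1) _ (index_enum 'I_e.+1)
     (fun i => c ^+ e * 'C(e, i)%:R * t ^+ i) (fun i => G i) tt mG (fun i _ _ => bHi i _).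
  rewrite [RHS](eq_bigr (fun i : 'I_e.+1 =>
      (c ^+ e * 'C(e, i)%:R * t ^+ i) * plane_moment a (e - i) i)) => [<-|i _].
    by apply: eq_Rintegral => x _; apply: eq_Rintegral => y _; exact: Hrot.
  by rewrite plane_moment.unlock dE// -ltnS.
rewrite integral_rotation// -HE// subn0 in rot.
rewrite rot mulr_sumr; apply: eq_bigr => i _.
rewrite !mulrA; congr (_ * _ * _); rewrite -exprMn /c divff ?expr1n ?mul1r//.
by rewrite gt_eqF// sqrtr_gt0.
Qed.

End PlaneRotation.

(** The difference would have as many distinct natural roots as its size. *)
Lemma poly_eq_horner (R : realFieldType) (p q : {poly R}) : (forall t, p.[t] = q.[t]) -> p = q.
Proof.
move=> pq; apply/eqP; rewrite -subr_eq0; apply/eqP.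
apply: (@roots_geq_poly_eq0 _ _ [seq i%:R | i <- iota 0 (size (p - q))]).
- by apply/allP => x _; rewrite rootE hornerD hornerN pq subrr.
- by rewrite map_inj_uniq ?iota_uniq// => i j /eqP; rewrite eqr_nat => /eqP.
- by rewrite size_map size_iota.
Qed.

(* Squaring avoids the parity of [d]: the polynomial [P] with coefficients
   [C(d, i) T_i] satisfies [P^2 = T_0^2 (1 + X^2)^d], hence [(1 + X^2) P' = d X P]. *)
Lemma binomial_sqrt_rec (R : rcfType) (T : nat -> R) (d a b : nat) :
  (forall t, \sum_(i < d.+1) 'C(d, i)%:R * t ^+ i * T i = Num.sqrt (1 + t ^+ 2) ^+ d * T 0%N) ->
  (a + b = d)%N -> (0 < b)%N -> a%:R * T b.+1 = b%:R * T b.-1.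
Proof.
move=> HT abd; case: b abd => // b abd _.
pose P := \poly_(i < d.+1) ('C(d, i)%:R * T i).
pose S : {poly R} := 1 + 'X ^+ 2.
have S2 t : S.[t] = 1 + t ^+ 2 by rewrite /S !hornerE.
have P2 : P ^+ 2 = (T 0%N ^+ 2)%:P * S ^+ d.
  apply: poly_eq_horner => t; rewrite horner_exp hornerM hornerC horner_exp S2.
  have -> : P.[t] = Num.sqrt (1 + t ^+ 2) ^+ d * T 0%N.
    by rewrite -HT horner_poly; apply: eq_bigr => i _; ring.
  rewrite exprMn -exprM mulnC exprM sqr_sqrtr 1?mulrC//.
  by have := sqr_ge0 t; lra.
(* Differentiate [P2], multiply by [S], and replace the right-hand side by means of [P2] again. *)
have PS : P * (P^`() * S) = P * (d%:R *: ('X * P)).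
  have dS : S^`() = 'X *+ 2 by rewrite /S derivD -[1]/(1%:P) derivC add0r derivXn.
  have := congr1 (fun p => p^`() * S) P2.
  rewrite deriv_exp derivM derivC mul0r add0r deriv_exp dS /=.
  have Sd : S ^+ d.-1 * S = S ^+ d by rewrite -exprSr prednK//; lia.
  have two0 : 2%:R != 0 :> R by rewrite pnatr_eq0.
  move=> E; apply: (scalerI two0); rewrite !scaler_nat.
  transitivity (P^`() * P ^+ 1 *+ 2 * S); first by ring.
  rewrite E; transitivity ((T 0%N ^+ 2)%:P * S ^+ d * 'X *+ d *+ 2).
    by rewrite -Sd; ring.
  by rewrite -P2; ring.
have P0 : P != 0 -> P^`() * S = d%:R *: ('X * P) by move=> P0; exact: (mulfI P0).
have cP i : P`_i = 'C(d, i)%:R * T i.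
  by rewrite coef_poly; case: ltnP => // di; rewrite bin_small// mul0r.
(* Coefficients of degree [b.+1] in the differential equation, where [d - b = a.+1]. *)
have cEq : P`_b.+2 * b.+2%:R = a.+1%:R * P`_b.
  have [PE|/P0/(congr1 (fun p : {poly R} => p`_b.+1))] := eqVneq P 0.
    by rewrite PE !coef0 mul0r mulr0.
  rewrite mulrDr mulr1 coefD coefMXn coefZ coefXM !coef_deriv /=.
  rewrite (_ : (if _ then _ else _) = b%:R * P`_b); last first.
    by case: (b) => [|c]; rewrite ?mul0r//= subn2 mulr_natl.
  rewrite -abd natrD -[_ *+ b.+2]mulr_natr => E.
  by rewrite -[LHS](addrK (b%:R * P`_b)) E -!natr1; ring.
rewrite !cP in cEq.
(* Multiplying by this binomial coefficient, the absorption identities [b1] and [b2] turn the goal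
   into [cEq]. *)
have C0 : 'C(d, b.+1)%:R != 0 :> R by rewrite pnatr_eq0 -lt0n bin_gt0; lia.
apply: (mulfI C0).
have b1 := congr1 (fun m => m%:R : R) (mul_bin_left d b.+1).
have b2 := congr1 (fun m => m%:R : R) (mul_bin_left d b).
rewrite !natrM in b1 b2.
rewrite (_ : (d - b.+1)%N = a) in b1; last lia.
rewrite (_ : (d - b)%N = a.+1) in b2; last lia.
by rewrite /= !mulrA [_ * a%:R]mulrC -b1 [X in X * T b]mulrC b2 -[RHS]mulrA -cEq; ring.
Qed.

(** * Recursion for the moments of the ball *)

Section BallMomentRecursion.
Variable R : realType.

(** Infinitesimal rotation invariance: the field x d/dy - y d/dx sends x^p y^q to q x^(p+1) y^(q-1)
    - p x^(p-1) y^(q+1), which has integral 0. For [p = 0] the truncated [p.-1] has coefficient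
    0. *)
Lemma plane_moment_rec n (a : 'I_n -> nat) (p q : nat) : (0 < q)%N ->
  p%:R * plane_moment a p.-1 q.+1 = q%:R * plane_moment a p.+1 q.-1 :> R.
Proof.
move=> q0; have H t := @plane_moment_rotation R n a (p + q) t.
have := @binomial_sqrt_rec R (fun i => plane_moment a (p + q - i) i) _ p q _ erefl q0.
rewrite subn0 => /(_ H); rewrite subnS addnK => ->.
by rewrite (_ : (p + q - q.-1)%N = p.+1)//; lia.
Qed.

Lemma ball_moment_sqr n (a : 'I_n -> nat) :
  \sum_k ball_moment (fun i => (i == k).*2 + a i)%N = ball_moment a :> R.
Proof.
have sE k : (\sum_i ((i == k).*2 + a i) = (\sum_i a i).+2)%N.
  rewrite big_split/= (bigD1 k)//= eqxx big1 ?addn0//.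
  by move=> i /negPf->.
pose F k (_ : unit) (s : seq R) :=
  weight (\sum_i a i).+2 (sqnorm n s) * monom (fun i => (i == k).*2 + a i)%N s.
have mF k : seq_measurable n (F k) by exact: seq_measurable_moment0.
have FC k t s : `|F k t s| <= 1.
  by apply: weight_bounded; rewrite -(sE k); exact: monom_bounded.
transitivity (\sum_k 1 * iter_int n (F k tt)).
  by apply: eq_bigr => k _; rewrite mul1r ball_moment.unlock sE.
rewrite -(iter_int_sum _ (fun=> 1) tt mF FC) ball_moment.unlock; apply: eq_iter_int => s _.
transitivity (\sum_(k < n) weight (\sum_i a i).+2 (sqnorm n s) * (nth 0 s k ^+ 2 * monom a s)).
  apply: eq_bigr => k _; rewrite mul1r; congr (_ * _).
  rewrite /monom (bigD1 k)//= eqxx exprD -mulrA [in RHS](bigD1 k)//=; congr (_ * (_ * _)).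
  by apply: eq_bigr => i /negPf->.
by rewrite -mulr_sumr -mulr_suml mulrA weight_sqr.
Qed.

(** [plane_moment_rec] in the plane of the coordinates [k] and [j], with [p = a k] and
    [q = (a j).+1]. *)
Lemma ball_moment_exchange n (a : 'I_n.+2 -> nat) (j k : 'I_n.+2) : j != k ->
  (a j).+1%:R * ball_moment (fun i => (i == k) + a i)%N
  = (a k)%:R * ball_moment (fun i => (i == j).*2 + (a i - (i == k)))%N :> R.
Proof.
move=> jk; have [k' jE|E] := unliftP k j; last by rewrite E eqxx in jk.
rewrite !(ball_moment_plane _ k k') -!jE !eqxx (negPf jk) [k == j]eq_sym (negPf jk) /=.
rewrite !add0n add1n subn0 subn1 add2n.
have lkF i : (lift k i == k) = false by rewrite eq_sym (negPf (neq_lift _ _)).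
rewrite (_ : (fun i => _) = (fun i => a (lift k (lift k' i)))); last first.
  by apply/funext => i; rewrite lkF.
rewrite [X in _ = _ * plane_moment X _ _](_ : _ = (fun i => a (lift k (lift k' i)))); last first.
  apply/funext => i; rewrite lkF jE (inj_eq lift_inj) eq_sym (negPf (neq_lift _ _)).
  by rewrite subn0.
by rewrite -plane_moment_rec.
Qed.

(** Expand the right-hand side by [ball_moment_sqr]. The term [j = k] yields the factor [a k] and
    each of the [n.+1] other terms yields [(a j).+1] by exchange; these factors add up to the one on
    the left. *)
Lemma ball_moment_rec n (a : 'I_n.+2 -> nat) k :
  (n.+1 + \sum_i a i)%:R * ball_moment (fun i => (i == k) + a i)%N
  = (a k)%:R * ball_moment (fun i => a i - (i == k))%N :> R.
Proof.
pose b i := (a i - (i == k))%N.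
have E : \sum_(j | j != k) (a j).+1%:R * ball_moment (fun i => (i == k) + a i)%N
   = (a k)%:R * \sum_(j | j != k) ball_moment (fun i => (i == j).*2 + b i)%N :> R.
  by rewrite mulr_sumr; apply: eq_bigr => j jk; exact: ball_moment_exchange.
have kE : (a k)%:R * ball_moment (fun i => (i == k).*2 + b i)%N
   = (a k)%:R * ball_moment (fun i => (i == k) + a i)%N :> R.
  have [->|ak] := posnP (a k); first by rewrite !mul0r.
  rewrite (_ : (fun i => _) = (fun i => (i == k) + a i)%N)//; apply/funext => i; rewrite /b.
  by have [->|_] := eqVneq i k; lia.
transitivity ((a k)%:R * \sum_j ball_moment (fun i => (i == j).*2 + b i)%N : R); last first.
  by rewrite ball_moment_sqr.
rewrite [in RHS](bigD1 k)//= mulrDr kE -E -mulr_suml -mulrDl.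
have -> : \sum_(j | j != k) (a j).+1%:R = n.+1%:R + (\sum_(j | j != k) a j)%:R :> R.
  rewrite -natr_sum -natrD; congr _%:R.
  under eq_bigr do rewrite -addn1.
  by rewrite big_split/= sum_nat_const cardC1 card_ord muln1 addnC.
have -> : (\sum_i a i = a k + \sum_(j | j != k) a j)%N by rewrite (bigD1 k).
by rewrite addrCA -!natrD.
Qed.

End BallMomentRecursion.

(** * Expectation on the sphere *)

Section SphereExpectation.
Context {R : realType}.

Lemma iter_int_cat a b (F : seq R -> R) :
  iter_int (a + b) F = iter_int a (fun s => iter_int b (fun s' => F (s ++ s'))).
Proof. by elim: a F => //= a IH F; apply: eq_Rintegral => x _; exact: IH. Qed.

Definition blk (n : nat) (s : seq R) (i : nat) : seq R := take n (drop (i * n) s).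

(** Fubini for products over blocks. The sum over [j] is carried along so that, in the induction,
    the value of the first block can be absorbed into the coefficients. *)
Lemma iter_int_blocks (N n : nat) (J : Type) (r : seq J) (c : J -> R)
    (phi : J -> nat -> seq R -> R) :
  (forall j i, seq_measurable n (fun _ : unit => phi j i)) ->
  (forall j i s, `|phi j i s| <= 1) ->
  iter_int (N * n) (fun s => \sum_(j <- r) c j * \prod_(i < N) phi j i (blk n s i))
  = \sum_(j <- r) c j * \prod_(i < N) iter_int n (phi j i).
Proof.
elim: N c phi => [|N IH] c phi mphi bphi.
  by rewrite /=; apply: eq_bigr => j _; rewrite !big_ord0.
rewrite mulSn iter_int_cat.
under [RHS]eq_bigr do rewrite big_ord_recl mulrA mulrAC.
have := @iter_int_sum R n _ unit 1 _ r (fun j => c j * \prod_(i < N) iter_int n (phi j i.+1))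
  (fun j _ => phi j 0%N) tt (fun j => mphi j 0%N) (fun j _ => bphi j 0%N).
move=> <-; apply: eq_iter_int => s sn.
have := IH (fun j => c j * phi j 0%N s) (fun j i => phi j i.+1)
  (fun j i => mphi j i.+1) (fun j i => bphi j i.+1).
under eq_bigr do rewrite mulrAC.
move=> <-; apply: eq_iter_int => s' _; apply: eq_bigr => j _.
rewrite big_ord_recl mulrA /blk mul0n drop0 take_size_cat//; congr (_ * _).
apply: eq_bigr => i _; congr (phi j _ (take _ _)).
by rewrite lift0 mulSn addnC -drop_drop drop_size_cat.
Qed.

Variables (n N : nat).
Implicit Types (sigma : 'I_N -> 'rV[R]_n) (es : seq ('I_N * 'I_N)).

Definition graph_prod es sigma : R := \prod_(e <- es) dotR (sigma e.1) (sigma e.2).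

Definition half_edge_prod (h : seq ('I_N * 'I_n)) sigma : R :=
  \prod_(x <- h) sigma x.1 ord0 x.2.

(** All choices of one coordinate per edge. It recurses as [graph_moment] does, which matches the
    expansion of the integrand with that of its expectation. *)
Fixpoint half_edges es (h : seq ('I_N * 'I_n)) : seq (seq ('I_N * 'I_n)) :=
  if es is (i, j) :: es' then
    flatten [seq half_edges es' [:: (i, k), (j, k) & h] | k <- index_enum 'I_n]
  else [:: h].

Lemma graph_prod_half_edges es h sigma :
  half_edge_prod h sigma * graph_prod es sigma
  = \sum_(h' <- half_edges es h) half_edge_prod h' sigma.
Proof.
elim: es h => [|[i j] es IH] h /=; first by rewrite /graph_prod big_nil mulr1 big_seq1.
rewrite big_flatten big_map /graph_prod big_cons /= mulrCA {1}/dotR mulr_suml.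
apply: eq_bigr => k _; rewrite -IH /half_edge_prod !big_cons /graph_prod /=.
by rewrite !mulrA.
Qed.

Lemma graph_moment_half_edges (M : ('I_n -> nat) -> R) es h :
  graph_moment M es h = \sum_(h' <- half_edges es h) moment M h'.
Proof.
elim: es h => [|[i j] es IH] h /=; first by rewrite big_seq1.
by rewrite big_flatten big_map; apply: eq_bigr => k _; rewrite IH.
Qed.

Lemma half_edge_prodE h sigma :
  half_edge_prod h sigma = \prod_(i < N) \prod_(k < n) sigma i ord0 k ^+ count_mem (i, k) h.
Proof.
rewrite /half_edge_prod; elim: h => [|[i k] h IH].
  by rewrite big_nil !big1// => i _; rewrite big1.
rewrite big_cons IH /= (bigD1 i)//= [RHS](bigD1 i)//= mulrA; congr (_ * _).
  rewrite (bigD1 k)//= [RHS](bigD1 k)//= mulrA xpair_eqE !eqxx/= -exprS; congr (_ * _).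
  by apply: eq_bigr => l lk; rewrite xpair_eqE [k == l]eq_sym (negPf lk) andbF.
apply: eq_bigr => j ji; apply: eq_bigr => l _.
by rewrite xpair_eqE [i == j]eq_sym (negPf ji).
Qed.

Lemma eucl_block s (i : 'I_N) : eucl (block n s i) = Num.sqrt (sqnorm n (blk n s i)).
Proof.
rewrite /eucl /dotR /sqnorm /blk; congr Num.sqrt; apply: eq_bigr => k _.
by rewrite !mxE nth_take// nth_drop expr2.
Qed.

Lemma eucl_normalize (u : 'rV[R]_n) : 0 < eucl u -> eucl (normalize u) = 1.
Proof.
move=> u0; rewrite /normalize {1}/eucl /dotR.
under eq_bigr do rewrite !mxE mulrACA.
rewrite -mulr_sumr sqrtrM ?mulr_ge0 ?invr_ge0 ?ltW// -expr2 sqrtr_sqr.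
by rewrite -/(dotR u u) -/(eucl u) ger0_norm ?invr_ge0 ?ltW// mulVf// gt_eqF.
Qed.

(** Both the indicator and the normalization factor over the blocks; the power of 1/|x| in block [i]
    is the number of half-edges at [i]. *)
Lemma balls_ind_half_edge_prod s (h : seq ('I_N * 'I_n)) :
  balls_ind n N s * half_edge_prod h (fun i => normalize (block n s i))
  = \prod_(i < N) (weight (\sum_k count_mem (i, k) h) (sqnorm n (blk n s i))
                    * monom (fun k => count_mem (i, k) h) (blk n s i)).
Proof.
have -> : balls_ind n N s = \prod_(i < N) weight 0 (sqnorm n (blk n s i)).
  rewrite /balls_ind; case: ifPn => [/forallP b|].
    rewrite big1// => i _; rewrite /weight; have := b i.
    rewrite eucl_block sqrtr_gt0 -[X in _ <= X]sqrtr1 ler_sqrt ?ler01// => ->.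
    by rewrite expr0.
  rewrite negb_forall => /existsP[i bi]; rewrite (bigD1 i)//= /weight ifF ?mul0r//.
  apply/negbTE; move: bi.
  by rewrite eucl_block sqrtr_gt0 -[X in _ <= X]sqrtr1 ler_sqrt ?ler01.
rewrite half_edge_prodE -big_split; apply: eq_bigr => i _ /=.
rewrite /weight; case: ifP => _; last by rewrite !mul0r.
rewrite expr0 mul1r /monom.
rewrite (big_morph (fun e => (Num.sqrt (sqnorm n (blk n s i)))^-1 ^+ e) (exprD _) (expr0 _)).
rewrite -big_split; apply: eq_bigr => k _ /=.
by rewrite /normalize !mxE eucl_block exprMn /blk nth_take// nth_drop.
Qed.

Definition sphere_moment (a : 'I_n -> nat) : R := ball_moment a / ball_moment (fun _ : 'I_n => 0%N).

Lemma iter_int_balls (J : Type) (r : seq J) (c : J -> R) (h : J -> seq ('I_N * 'I_n)) :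
  iter_int (N * n) (fun s => balls_ind n N s *
    \sum_(j <- r) c j * half_edge_prod (h j) (fun i => normalize (block n s i)))
  = \sum_(j <- r) c j * \prod_(i < N) ball_moment (fun k => count_mem (i, k) (h j)).
Proof.
(* Vertices are indexed by [nat] here, to fit the form of [iter_int_blocks]. *)
pose cnt j (i : nat) (k : 'I_n) :=
  count (fun x : 'I_N * 'I_n => (val x.1 == i) && (x.2 == k)) (h j).
have cntE j (i : 'I_N) : cnt j i = (fun k => count_mem (i, k) (h j)).
  by apply/funext => k; apply: eq_count => -[a b] /=; rewrite xpair_eqE.
pose phi j i (s : seq R) := weight (\sum_k cnt j i k) (sqnorm n s) * monom (cnt j i) s.
have mphi j i : seq_measurable n (fun _ : unit => phi j i) by exact: seq_measurable_moment0.
have bphi j i s : `|phi j i s| <= 1 by apply: weight_bounded; exact: monom_bounded.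
transitivity (\sum_(j <- r) c j * \prod_(i < N) iter_int n (phi j i)).
  rewrite -(iter_int_blocks _ _ _ mphi bphi); apply: eq_iter_int => s _.
  rewrite mulr_sumr; apply: eq_bigr => j _; rewrite mulrCA balls_ind_half_edge_prod.
  by congr (_ * _); apply: eq_bigr => i _; rewrite /phi cntE.
apply: eq_bigr => j _; congr (_ * _); apply: eq_bigr => i _.
by rewrite ball_moment.unlock /phi cntE.
Qed.

Lemma iter_int_balls_ind :
  iter_int (N * n) (balls_ind n N) = ball_moment (fun _ : 'I_n => 0%N) ^+ N :> R.
Proof.
have := iter_int_balls [:: tt] (fun=> 1) (fun=> [::]).
rewrite big_seq1 mul1r /= prodr_const card_ord => <-.
by apply: eq_iter_int => s _; rewrite big_seq1 /half_edge_prod big_nil !mulr1.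
Qed.

Lemma Esph_graph (J : finType) (c : J -> R) (es : J -> seq ('I_N * 'I_N)) f :
  (forall sigma, (forall i, on_sphere (sigma i)) ->
     f sigma = \sum_j c j * graph_prod (es j) sigma) ->
  Esph f = \sum_j c j * graph_moment sphere_moment (es j) [::].
Proof.
move=> fE; pose r := [seq (j, h) | j <- index_enum J, h <- half_edges (es j) [::]].
rewrite /Esph iter_int_balls_ind.
have -> : iter_int (N * n) (fun s => balls_ind n N s * f (fun i => normalize (block n s i)))
    = \sum_(x <- r) c x.1 * \prod_(i < N) ball_moment (fun k => count_mem (i, k) x.2).
  rewrite -iter_int_balls; apply: eq_iter_int => s _.
  (* The formula for [f] holds on the sphere only: where the indicator is 1 the normalized blocks
     are unit vectors, and elsewhere both integrands vanish. *)
  have [b1|b0] := boolP [forall i : 'I_N, (0 < eucl (block n s i)) && (eucl (block n s i) <= 1)];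
    last by rewrite /balls_ind (negPf b0) !mul0r.
  rewrite fE => [|i]; last first.
    by apply: eucl_normalize; move/forallP: b1 => /(_ i)/andP[].
  congr (_ * _); rewrite big_allpairs_dep /=; apply: eq_bigr => j _.
  rewrite -mulr_sumr -graph_prod_half_edges /half_edge_prod big_nil mul1r//.
rewrite mulr_suml big_allpairs_dep /=; apply: eq_bigr => j _.
rewrite graph_moment_half_edges mulr_sumr; apply: eq_bigr => h _.
by rewrite -mulrA /moment /sphere_moment big_split /= prodr_const card_ord exprVn.
Qed.

(** An exponent becomes a number of parallel edges. *)
Lemma in_E_graph f : in_E f -> exists m (c : 'I_m -> R) (es : 'I_m -> seq ('I_N * 'I_N)),
  (forall k, 0 < c k) /\ forall sigma, (forall i, on_sphere (sigma i)) ->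
     f sigma = \sum_k c k * graph_prod (es k) sigma.
Proof.
move=> [m [c [e [c0 fE]]]]; exists m, c.
exists (fun k => flatten [seq flatten [seq nseq (e k i j) (i, j)
  | j : 'I_N <- index_enum 'I_N & (i < j)%N] | i : 'I_N <- index_enum 'I_N]).
split=> // sigma /fE ->; apply: eq_bigr => k _; congr (_ * _).
rewrite /graph_prod big_flatten big_map; apply: eq_bigr => i _.
rewrite big_flatten big_map big_filter; apply: eq_bigr => j _.
by rewrite big_nseq iter_mulr_1.
Qed.

End SphereExpectation.

Lemma wick_sphere (R : realType) (n : nat) (V : finType) :
  ball_moment (fun _ : 'I_n.+2 => 0%N) != 0 :> R ->
  wick n.+2 (fun es : seq (V * V) => graph_moment (@sphere_moment R n.+2) es [::]).
Proof.
move=> v0; apply: wick_graph_moment => [|a|a k]; rewrite /sphere_moment.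
- by rewrite divff.
- by rewrite -mulr_suml ball_moment_sqr.
- by rewrite !mulrA ball_moment_rec.
Qed.

Theorem theorem1 (R : realType) (n N : nat) (hn : (2 <= n)%N) (hN : (1 <= N)%N)
  (f g : ('I_N -> 'rV[R]_n) -> R) :
  in_E f -> in_E g ->
  0 <= Esph f /\ Esph f * Esph g <= Esph (fun sigma => f sigma * g sigma).
Proof.
case: n hn f g => [|[|n]]// hn f g.
(* Positivity of the volume is not needed: were it 0, [Esph] would vanish as [x / 0 = 0]. *)
have [v0|v0] := eqVneq (ball_moment (fun _ : 'I_n.+2 => 0%N) : R) 0.
  by rewrite /Esph iter_int_balls_ind v0 expr0n eqn0Ngt hN invr0 !mulr0.
move=> /in_E_graph[m [c [es [c0 fE]]]] /in_E_graph[p [b [fs [b0 gE]]]].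
have wE V := @wick_sphere R n V v0.
have n1 : (1 < n.+2)%N by [].
(* The product of two monomials is the monomial of the concatenated edge lists, so the claim reduces
   to [wick_correlation] for each pair of monomials. *)
have fgE sigma : (forall i, on_sphere (sigma i)) -> f sigma * g sigma
    = \sum_(x : 'I_m * 'I_p) (c x.1 * b x.2) * graph_prod (es x.1 ++ fs x.2) sigma.
  move=> sp; rewrite fE// gE// big_distrlr/= pair_big; apply: eq_bigr => x _.
  by rewrite mulrACA /graph_prod big_cat.
rewrite (Esph_graph fE) (Esph_graph gE) (Esph_graph fgE); split.
  by apply: sumr_ge0 => k _; apply: mulr_ge0; [exact: ltW|exact: (wick_ge0 n1 _ (wE _))].
rewrite big_distrlr/= pair_big; apply: ler_sum => x _.
rewrite mulrACA; apply: ler_wpM2l; first by apply: mulr_ge0; exact: ltW.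
exact: (wick_correlation n1 _ _ (wE _) (wE _)).
Qed.
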